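(* In the two-tier network model described in the context, let $W>0$ be the total bandwidth, $\eta\in[0,1]$ the fraction of it allotted to the access link, and $\gamma_0>0$ the SINR threshold. Then the average potential throughput $\mathcal{R}_m(\eta,\gamma_0)$ of the MBS tier satisfies $$\mathcal{R}_m(\eta,\gamma_0)=\lambda_m\eta W\log_2(1+\gamma_0)\,P^{cov}_{m,\mathrm{L}}(\gamma_0)+\lambda_m\eta W\log_2(1+\gamma_0)\,P^{cov}_{m,\mathrm{NL}}(\gamma_0),$$ where $P^{cov}_{m,\mathrm{L}}(\gamma_0)$ (respectively $P^{cov}_{m,\mathrm{NL}}(\gamma_0)$) is the probability that the typical user is associated with an MBS via a LoS (respectively NLoS) path and that its SINR is at least $\gamma_0$.
   Context: Network. Small base stations (SBSs, tier $s$) and macro base stations (MBSs, tier $m$) are located at the points of independent homogeneous Poisson point processes $\Phi_s,\Phi_m$ in $\mathbb{R}^2$ with densities $\lambda_s,\lambda_m>0$. The typical user is at the origin. Path loss. Let $A_{\mathrm{L}},A_{\mathrm{NL}},\alpha_{\mathrm{L}},\alpha_{\mathrm{NL}}>0$ and $\beta\ge 0$. Independently for each base station, the link from a base station at distance $r$ to the user is line-of-sight (LoS) with probability $\mathcal{P}_{\mathrm{L}}(r)=\min\left(\frac{18}{r},1\right)(1-e^{-\beta r})+e^{-\beta r}$, in which case its path loss is $L(r)=A_{\mathrm{L}}r^{-\alpha_{\mathrm{L}}}$; otherwise it is non-line-of-sight (NLoS), in which case $L(r)=A_{\mathrm{NL}}r^{-\alpha_{\mathrm{NL}}}$. Powers,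 fading, noise. A base station of tier $k\in\{s,m\}$ has transmit power $P_k^{tr}>0$ and association bias $B_k>0$. Each link to the user has power fading $h$, exponentially distributed with mean $1$; all fadings are mutually independent and independent of locations and LoS/NLoS states. $N_0>0$ is the noise power. Association. The user is associated with the base station (over both tiers) maximizing the biased received power averaged over fading, $P_k^{tr}B_kL(r)$. SINR. If the serving base station is in tier $k$ at distance $r$ with path loss $L(r)$ and fading $h$, the SINR is $\frac{P_k^{tr}B_k\,h\,L(r)}{I+N_0}$, where $I$ is the sum over all other base stations of both tiers of (transmit power)$\times$(bias)$\times$(fading)$\times$(path loss). Average potential throughput (APT). For a tier of base stations with density $\lambda_{bs}$ using bandwidth $W'$ and SINR threshold $\gamma$, the APT is $\lambda_{bs}W'\log_2(1+\gamma)\,\mathbb{P}\{\mathrm{SINR}\ge\gamma\}$, where $\mathbb{P}\{\mathrm{SINR}\ge\gamma\}$ is the probability that the typical user is associated with that tier and its SINR is at least $\gamma$. The MBS tier serves users directly over the access link, which has bandwidth $W_{ac}=\eta W$; $\mathcal{R}_m(\eta,\gamma_0)$ is the APT of the MBS tier with $\lambda_{bs}=\lambda_m$, $W'=\eta W$, $\gamma=\gamma_0$. *)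

(* Defs.v *)
From HB Require Import structures.
From mathcomp Require Import all_boot all_order all_algebra.
From mathcomp Require Import all_classical all_reals all_analysis.

Set Implicit Arguments.
Unset Strict Implicit.
Unset Printing Implicit Defensive.

Import Order.TTheory GRing.Theory Num.Theory.
Import numFieldNormedType.Exports.

Local Open Scope classical_set_scope.
Local Open Scope ring_scope.

Inductive tier := SBS | MBS.

Definition bool_of_tier (k : tier) : bool := if k is MBS then true else false.
Definition tier_of_bool (b : bool) : tier := if b then MBS else SBS.
Lemma bool_of_tierK : cancel bool_of_tier tier_of_bool. Proof. by case. Qed.
HB.instance Definition _ := Finite.copy tier (can_type bool_of_tierK).

(* Link states are Booleans. *)
Definition LoS : bool := true.
Definition NLoS : bool := false.

(* A base station is named by its tier and its index in an enumeration of the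
   (almost surely infinite) set of points of that tier. *)
Definition bs : Type := (tier * nat)%type.

Record params (R : realType) := Params {
  density : tier -> R;
  AL : R;
  ANL : R;
  alphaL : R;
  alphaNL : R;
  beta : R;
  power : tier -> R;
  bias : tier -> R;
  noise : R }.

Record params_ok (R : realType) (p : params R) : Prop := ParamsOk {
  density_gt0 : forall k, 0 < density p k;
  AL_gt0 : 0 < AL p;
  ANL_gt0 : 0 < ANL p;
  alphaL_gt0 : 0 < alphaL p;
  alphaNL_gt0 : 0 < alphaNL p;
  beta_ge0 : 0 <= beta p;
  power_gt0 : forall k, 0 < power p k;
  bias_gt0 : forall k, 0 < bias p k;
  noise_gt0 : 0 < noise p }.

(* At r = 0 the junk values [18 / 0 = 0] and [0 `^ (- a) = 0] are used; a base
   station lies at the origin with probability zero. *)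
Definition prob_los (R : realType) (p : params R) (r : R) : R :=
  Num.min (18 / r) 1 * (1 - expR (- beta p * r)) + expR (- beta p * r).

Definition path_loss (R : realType) (p : params R) (los : bool) (r : R) : R :=
  if los == LoS then AL p * r `^ (- alphaL p) else ANL p * r `^ (- alphaNL p).

Definition log2 (R : realType) (x : R) : R := ln x / ln 2.

(* [|x|] on [R * R] is the sup norm, hence the explicit Euclidean norm. *)
Definition dist0 (R : realType) (x : R * R) : R :=
  Num.sqrt (x.1 ^+ 2 + x.2 ^+ 2).

Definition area (R : realType) : set (R * R) -> \bar R :=
  (@lebesgue_measure R \x @lebesgue_measure R)%E.

Record network d (T : measurableType d) (R : realType) (P : probability T R) :=
  Network {
    location : bs -> {RV P >-> (R * R)%type};
    is_los : bs -> {RV P >-> bool};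
    fading : bs -> {RV P >-> R} }.

Section PoissonProcess.
Context d (T : measurableType d) (R : realType) (P : probability T R).
Implicit Types X Y : nat -> {RV P >-> (R * R)%type}.

Definition points_in X (B : set (R * R)) (w : T) : \bar R :=
  counting [set i | B (X i w)].

Definition count_event X (B : set (R * R)) (n : nat) : set T :=
  [set w | points_in X B w = n%:R%:E].

(* The second argument of [poisson_prob] is a dummy. *)
Record poisson_process (lambda : R) X : Prop := PoissonProcess {
  poisson_counts : forall (B : set (R * R)) (n : nat),
    measurable B -> (area B < +oo)%E ->
    P (count_event X B n) =
      poisson_prob (lambda * fine (area B)) 0 [set n];
  poisson_indep : forall (m : nat) (B : 'I_m -> set (R * R)) (n : 'I_m -> nat),
    (forall j, measurable (B j)) -> (forall j, (area (B j) < +oo)%E) ->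
    trivIset setT B ->
    P (\bigcap_(j in setT) count_event X (B j) (n j)) =
      (\prod_(j < m) P (count_event X (B j) (n j)))%E }.

Definition sigma_process X : set (set T) :=
  <<s [set E | exists (B : set (R * R)) (n : nat),
         measurable B /\ E = count_event X B n] >>.

Definition indep_processes X Y : Prop :=
  forall E F, sigma_process X E -> sigma_process Y F ->
    P (E `&` F) = (P E * P F)%E.

End PoissonProcess.

Section Network.
Context d (T : measurableType d) (R : realType) (P : probability T R).
Variables (p : params R) (N : network P).

Definition distance (b : bs) (w : T) : R := dist0 (location N b w).

Definition locations_of (k : tier) : nat -> {RV P >-> (R * R)%type} :=
  fun i => location N (k, i).

Definition location_events : set (set T) :=
  [set E | exists (b : bs) (B : set (R * R)),
     measurable B /\ E = location N b @^-1` B].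

Definition los_events : set (set T) :=
  [set E | exists (b : bs) (l : bool), E = [set w | is_los N b w = l]].

(* [los_marking]: given the locations of all base stations, the LoS states are
   independent and station [b] is LoS with probability
   [prob_los p (distance b)].
   [fading_indep]: the fadings are independent of one another and, jointly, of
   the locations and LoS states. *)
Record network_ok : Prop := NetworkOk {
  tiers_poisson : forall k, poisson_process (density p k) (locations_of k);
  tiers_indep : indep_processes (locations_of SBS) (locations_of MBS);
  los_marking : forall (E : set T) (s : seq bs) (l : bs -> bool),
    <<s location_events >> E -> uniq s ->
    P (E `&` [set w | forall b, b \in s -> is_los N b w = l b]) =
      (\int[P]_(w in E)
         (\prod_(b <- s) (if l b == LoS then prob_los p (distance b w)
                          else 1 - prob_los p (distance b w)))%:E)%E;
  fading_exponential : forall (b : bs) (B : set R), measurable B ->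
    distribution P (fading N b) B = exponential_prob 1 B;
  fading_indep : forall (E : set T) (s : seq bs) (B : bs -> set R),
    <<s location_events `|` los_events >> E -> uniq s ->
    (forall b, measurable (B b)) ->
    P (E `&` [set w | forall b, b \in s -> B b (fading N b w)]) =
      (P E * \prod_(b <- s) distribution P (fading N b) (B b))%E }.

Definition mean_biased_power (b : bs) (w : T) : R :=
  power p b.1 * bias p b.1 * path_loss p (is_los N b w) (distance b w).

Definition biased_power (b : bs) (w : T) : R :=
  power p b.1 * bias p b.1 * fading N b w
    * path_loss p (is_los N b w) (distance b w).

(* A weak maximum: ties are not excluded by definition, they have probability
   zero. *)
Definition serves (b : bs) (w : T) : Prop :=
  forall b' : bs, mean_biased_power b' w <= mean_biased_power b w.

(* The value may be infinite (path-loss exponents at most 2); then the SINR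
   is 0. *)
Definition interference (b : bs) (w : T) : \bar R :=
  (\esum_(b' in [set b' : bs | b' != b]) (biased_power b' w)%:E)%E.

Definition SINR (b : bs) (w : T) : \bar R :=
  ((biased_power b w)%:E / (interference b w + (noise p)%:E))%E.

Definition covered (k : tier) (gamma : R) : set T :=
  [set w | exists i : nat, serves (k, i) w /\ (gamma%:E <= SINR (k, i) w)%E].

Definition covered_via (k : tier) (los : bool) (gamma : R) : set T :=
  [set w | exists i : nat, [/\ serves (k, i) w, is_los N (k, i) w = los
                             & (gamma%:E <= SINR (k, i) w)%E]].

Definition Pcov (k : tier) (los : bool) (gamma : R) : R :=
  fine (P (covered_via k los gamma)).

Definition APT (k : tier) (bandwidth gamma : R) : R :=
  density p k * bandwidth * log2 (1 + gamma) * fine (P (covered k gamma)).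

(* [eta] is the fraction of the total bandwidth [W] given to the access link. *)
Definition macro_APT (W eta gamma : R) : R := APT MBS (eta * W) gamma.

End Network.

(* Main.v *)
(* A covered user is served over a LoS or over a NLoS link, so the coverage
   event is a union of two measurable events and only their intersection has to
   be null. On it two stations of the same tier, one LoS and one NLoS, have the
   same mean power, hence their distances satisfy r_j = h(r_i) for a fixed
   measurable h. Such a tie is null for a Poisson process: disjoint sets A, B
   both contain a point with probability at most lambda^2 |A| |B|, a set B
   contains two points with probability at most lambda^2 |B|^2, and summing over
   the annuli of a fine radial partition of a bounded region gives a bound
   proportional to the area of the largest annulus, which is arbitrarily
   small. *)
Require Import Defs.
From mathcomp Require Import all_boot all_order all_algebra finmap.
From mathcomp Require Import all_classical all_reals all_analysis measurable_realfun.
From mathcomp Require Import ring lra.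
Set Implicit Arguments.
Unset Strict Implicit.
Unset Printing Implicit Defensive.
Import Order.TTheory GRing.Theory Num.Theory.
Import numFieldNormedType.Exports.
Local Open Scope classical_set_scope.
Local Open Scope ring_scope.

Lemma area_ge0 (R : realType) (B : set (R * R)) : (0 <= area B)%E.
Proof. exact: measure_ge0. Qed.

(** * Poisson process: probability that two given points fall in given sets *)

Section PoissonPairs.
Context d (T : measurableType d) (R : realType) (P : probability T R).
Context (lambda : R) (X : nat -> {RV P >-> (R * R)%type}).
Hypothesis lambda0 : 0 < lambda.
Hypothesis XP : poisson_process lambda X.

(** [counting] is infinite on infinite sets, so a finite count makes the set of indices a finite
    set. There are only countably many of these, which turns the event into a countable union and
    gives its measurability. *)
Lemma count_eventE (B : set (R * R)) n w :
  count_event X B n w <->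
  exists2 s : {fset nat}, #|` s| = n & [set i | B (X i w)] = [set` s].
Proof.
rewrite /count_event /points_in /counting /=; case: asboolP => fin; split.
- move=> /eqP; rewrite eqe eqr_nat => /eqP sn.
  by exists (fset_set [set i | B (X i w)]); rewrite ?fset_setK.
- by case=> s <- ->; rewrite set_fsetK.
- by [].
- by case=> s _ sE; case: fin; rewrite sE; exact: finite_fset.
Qed.

Lemma measurable_count_event (B : set (R * R)) n :
  measurable B -> measurable (count_event X B n).
Proof.
move=> mB.
have -> : count_event X B n = \bigcup_(s in [set s : {fset nat} | #|` s| = n])
    \bigcap_(i in setT) (if i \in s then X i @^-1` B else ~` (X i @^-1` B)).
  apply/seteqP; split => [w /count_eventE[s sn /seteqP[sE Es]]|w [s /= sn sE]].
    exists s => // i _; case: ifPn => [/Es//|/negP is_ Bi]; exact/is_/sE.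
  apply/count_eventE; exists s => //; apply/seteqP; split => i /=.
    by have := sE i Logic.I; case: ifPn.
  by move=> is_; have := sE i Logic.I; rewrite is_.
rewrite bigcup_mkcond; apply: countable_bigcupT_measurable => // s.
case: ifPn => // _; apply: bigcapT_measurable => i.
have mX : measurable (X i @^-1` B) by rewrite -[_ @^-1` _]setTI; exact: measurable_funP.
by case: ifPn => // _; exact: measurableC.
Qed.

Lemma void_probability (B : set (R * R)) : measurable B -> (area B < +oo)%E ->
  P (count_event X B 0) = (expR (- (lambda * fine (area B))))%:E.
Proof.
move=> mB fB; rewrite (poisson_counts XP)// /poisson_prob; case: ifPn => l0.
  by rewrite esum_set1 ?lee_fin ?poisson_pmf_ge0// /poisson_pmf l0 expr0 fact0 invr1 !mul1r.
(* When the rate is not positive it must be 0, and [poisson_prob] is then the Dirac mass at 0, in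
   agreement with the formula. *)
have -> : lambda * fine (area B) = 0.
  by apply/eqP; rewrite eq_le leNgt l0/= mulr_ge0 ?fine_ge0 ?area_ge0 ?(ltW lambda0).
by rewrite diracE oppr0 expR0 mem_set.
Qed.

Lemma single_probability (B : set (R * R)) : measurable B -> (area B < +oo)%E ->
  P (count_event X B 1) =
  (lambda * fine (area B) * expR (- (lambda * fine (area B))))%:E.
Proof.
move=> mB fB; rewrite (poisson_counts XP)// /poisson_prob; case: ifPn => l0.
  by rewrite esum_set1 ?lee_fin ?poisson_pmf_ge0// /poisson_pmf l0 expr1 invr1 mulr1.
have -> : lambda * fine (area B) = 0.
  by apply/eqP; rewrite eq_le leNgt l0/= mulr_ge0 ?fine_ge0 ?area_ge0 ?(ltW lambda0).
by rewrite diracE mul0r memNset.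
Qed.

(** Neither set is void. By independence of the counts this has probability (1 - exp(-x)) (1 -
    exp(-y)), with x and y the mean counts, and 1 - exp(-x) <= x. *)
Lemma pair_in_disjoint (A B : set (R * R)) i j :
  measurable A -> measurable B -> (area A < +oo)%E -> (area B < +oo)%E ->
  A `&` B = set0 ->
  (P (X i @^-1` A `&` X j @^-1` B) <= (lambda ^+ 2)%:E * area A * area B)%E.
Proof.
move=> mA mB fA fB AB.
pose E := count_event X A 0; pose F := count_event X B 0.
have mE : measurable E by exact: measurable_count_event.
have mF : measurable F by exact: measurable_count_event.
have PEF : P (E `&` F) = (P E * P F)%E.
  pose AB_ (k : 'I_2) := if k == 0 then A else B.
  have := @poisson_indep _ _ _ _ _ _ XP 2 AB_ (fun=> 0%N).
  rewrite !big_ord_recl big_ord0 mule1 /AB_/= => <-.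
  - congr (P _); apply/seteqP; split => [w [Ew Fw] k _|w kw]/=.
      by case: ifPn.
    by split; [exact: (kw ord0)|exact: (kw (lift ord0 ord0))].
  - by move=> k; case: ifPn.
  - by move=> k; case: ifPn.
  - apply/trivIsetP => k l _ _ /=.
    case: (eqVneq k 0) => [k0|k0]; case: (eqVneq l 0) => [l0|l0]//.
    + by rewrite k0 l0 eqxx.
    + by rewrite setIC.
    + have k1 : k = 1 by apply/val_inj; case: k k0 => [[|[|]]].
      have -> : l = 1 by apply/val_inj; case: l l0 => [[|[|]]].
      by rewrite k1 eqxx.
apply: (@le_trans _ _ (P (~` (E `|` F)))).
  apply: le_measure; rewrite ?inE.
  - by apply: measurableI; rewrite -[_ @^-1` _]setTI; exact: measurable_funP.
  - by apply: measurableC; exact: measurableU.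
  - move=> w [/= Xi Xj] [] /count_eventE[s /eqP]; rewrite cardfs_eq0 => /eqP ->.
    + by move=> /seteqP[/(_ i Xi)].
    + by move=> /seteqP[/(_ j Xj)].
have PU : P (E `|` F) = (P E + P F - P (E `&` F))%E.
  by apply: measureUfinl => //; rewrite (le_lt_trans (probability_le1 _ _))// ltry.
rewrite probability_setC ?PU; last exact: measurableU.
have [/fineK <- /fineK <-] : area A \is a fin_num /\ area B \is a fin_num.
  by rewrite !ge0_fin_numE ?area_ge0.
rewrite PEF !void_probability//.
rewrite -!(EFinM,EFinD,EFinN,EFinB) lee_fin.
set a := fine (area A); set b := fine (area B).
have a0 : 0 <= a by rewrite fine_ge0.
have b0 : 0 <= b by rewrite fine_ge0.
have := expR_ge1Dx (- (lambda * a)); have := expR_ge1Dx (- (lambda * b)).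
have : expR (- (lambda * a)) <= 1 by rewrite -expR0 ler_expR oppr_le0 mulr_ge0// ltW.
have : expR (- (lambda * b)) <= 1 by rewrite -expR0 ler_expR oppr_le0 mulr_ge0// ltW.
set u := expR _; set v := expR _ => u1 v1 ub va.
have -> : 1 - (v + u - v * u) = (1 - v) * (1 - u) by ring.
have -> : lambda ^+ 2 * a * b = (lambda * a) * (lambda * b) by ring.
by apply: ler_pM; lra.
Qed.

(** Points are counted by index, so two distinct indices exclude the counts 0 and 1, even if the
    points coincide. With x the mean count, 1 - exp(-x) - x exp(-x) <= 1 - (1 + x) (1 - x) = x^2. *)
Lemma pair_in_same (B : set (R * R)) i j :
  measurable B -> (area B < +oo)%E -> i != j ->
  (P (X i @^-1` B `&` X j @^-1` B) <= (lambda ^+ 2)%:E * area B * area B)%E.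
Proof.
move=> mB fB ij.
pose E := count_event X B 0; pose F := count_event X B 1.
have mE : measurable E by exact: measurable_count_event.
have mF : measurable F by exact: measurable_count_event.
apply: (@le_trans _ _ (P (~` (E `|` F)))).
  apply: le_measure; rewrite ?inE.
  - by apply: measurableI; rewrite -[_ @^-1` _]setTI; exact: measurable_funP.
  - by apply: measurableC; exact: measurableU.
  - move=> w [/= Xi Xj] [] /count_eventE[s /eqP]; last first.
    + move=> /cardfs1P[k ->] /seteqP[sk _]; case/eqP: ij.
      by have := sk i Xi; have := sk j Xj; rewrite /= !inE => /eqP -> /eqP ->.
    + by rewrite cardfs_eq0 => /eqP -> /seteqP[/(_ i Xi)].
have PU : P (E `|` F) = (P E + P F)%E.
  apply: measureU => //; rewrite -subset0 => w [].
  by rewrite /E /F /count_event /= => -> /eqP; rewrite eqe eqr_nat.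
rewrite probability_setC ?PU; last exact: measurableU.
have /fineK <- : area B \is a fin_num by rewrite ge0_fin_numE ?area_ge0.
rewrite void_probability// single_probability//.
rewrite -!(EFinM,EFinD,EFinN,EFinB) lee_fin.
set b := fine (area B).
have b0 : 0 <= lambda * b by rewrite mulr_ge0 ?fine_ge0// ltW.
have := expR_ge1Dx (- (lambda * b)).
set u := expR _ => ub.
have -> : lambda ^+ 2 * b * b = (lambda * b) * (lambda * b) by ring.
nra.
Qed.

End PoissonPairs.

(** * Areas of thin annuli, disjoint slices and bounded boxes *)

Definition sqnorm {R : realType} (x : R * R) : R := x.1 ^+ 2 + x.2 ^+ 2.

Lemma measurable_sqnorm (R : realType) : measurable_fun setT (@sqnorm R).
Proof.
by apply: measurable_funD; apply: measurable_funX;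
  [exact: measurable_fst|exact: measurable_snd].
Qed.

(** By Fubini: each vertical section lies in two intervals of length [Num.sqrt e], and the abscissas
    range over an interval of length 2 M. The bound is cruder than the true order [e], but it is
    uniform in [s] and tends to 0 with [e], which is enough. *)
Lemma area_thin_annulus (R : realType) (M s e : R) (A : set (R * R)) :
  0 <= M -> 0 <= e -> measurable A ->
  A `<=` [set x | `|x.1| <= M] `&` [set x | s <= sqnorm x < s + e] ->
  (area A <= (4 * M * Num.sqrt e)%:E)%E.
Proof.
move=> M0 e0 mA AM.
rewrite /area /product_measure1/=.
have -> : (4 * M * Num.sqrt e)%:E =
   (\int[@lebesgue_measure R]_(x in setT) (cst (2 * Num.sqrt e)%:E \_ `[(- M)%R, M]%classic) x)%E.
  rewrite -integral_mkcond integral_cst//= lebesgue_measure_itv/= lte_fin.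
  case: ltP => MM.
    by rewrite -EFinD -EFinM; congr EFin; ring.
  have -> : M = 0 by lra.
  by rewrite mule0 mulr0 mul0r.
apply: ge0_le_integral => //=.
- exact: measurable_fun_xsection.
- apply/(measurable_restrictT _ _).1 => //.
move=> x _; rewrite patchE; case: ifPn => [xM|xM]; last first.
  rewrite (_ : xsection A x = set0) ?measure0// -subset0 => y /xsectionP/AM[/= xM' _].
  by move: xM; rewrite notin_setE/= in_itv/=; apply; rewrite -ler_norml.
(* [Num.sqrt] is 0 on negative numbers, so [a] is 0 where the section misses the inner disc. In all
   cases y^2 < s + e - x^2 <= a^2 + b^2 <= (a + b)^2. *)
set a := Num.sqrt (s - x ^+ 2); set b := Num.sqrt e.
have a0 : 0 <= a by exact: sqrtr_ge0.
have b0 : 0 <= b by exact: sqrtr_ge0.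
apply: (@le_trans _ _ (lebesgue_measure (`[a, a + b]%classic `|` `[- a - b, - a]%classic))).
  apply: le_measure; rewrite ?inE.
  - exact: measurable_xsection.
  - exact: measurableU.
  move=> y /xsectionP/AM[_ /=]; rewrite /sqnorm/= => /andP[sy ys].
  have ya : a <= `|y|.
    by rewrite -(sqrtr_sqr y) ler_wsqrtr//; lra.
  have yab : `|y| <= a + b.
    rewrite -ler_sqr ?nnegrE ?addr_ge0// real_normK ?num_real//.
    have b2 : b ^+ 2 = e by rewrite sqr_sqrtr.
    have a2 : s - x ^+ 2 <= a ^+ 2.
      have [h|h] := leP 0 (s - x ^+ 2); first by rewrite sqr_sqrtr.
      by apply: (le_trans (ltW h)); exact: sqr_ge0.
    have ab : 0 <= a * b by exact: mulr_ge0.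
    have -> : (a + b) ^+ 2 = a ^+ 2 + 2 * (a * b) + b ^+ 2 by ring.
    lra.
  rewrite !in_itv/=; case: (leP 0 y) => y0; [left|right].
  - by move: ya yab; rewrite ger0_norm// => -> ->.
  - by move: ya yab; rewrite ltr0_norm// => h1 h2; apply/andP; split; lra.
have U2 (A1 A2 : set R) : measurable A1 -> measurable A2 ->
    (lebesgue_measure (A1 `|` A2) <= lebesgue_measure A1 + lebesgue_measure A2)%E.
  exact: (measureU2 (@lebesgue_measure R)).
apply: (le_trans (U2 _ _ (measurable_itv _) (measurable_itv _))).
rewrite !lebesgue_measure_itv/= !lte_fin.
have -> : (2 * b)%:E = (b%:E + b%:E)%E by rewrite -EFinD; congr EFin; ring.
by apply: leeD; case: ifPn => _; rewrite -?EFinD ?lee_fin//; lra.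
Qed.

Lemma sum_area_le (R : realType) (D : set (R * R)) (F : nat -> set (R * R)) :
  measurable D -> (forall b, measurable (F b)) -> trivIset setT F ->
  (forall b, F b `<=` D) -> (\sum_(0 <= b <oo) area (F b) <= area D)%E.
Proof.
move=> mD mF tF FD.
have areaU : (area (\bigcup_b F b) = \sum_(0 <= b <oo | b \in setT) area (F b))%E.
  have := measure_bigcup (@lebesgue_measure R \x @lebesgue_measure R)%E setT F.
  by apply => // b _; exact: mF.
rewrite (eq_eseriesl (Q := fun b => b \in [set: nat])) => [|b]; last by rewrite in_setT.
rewrite -areaU.
by apply: le_measure; rewrite ?inE//; [exact: bigcupT_measurable|exact: bigcup_sub].
Qed.

Lemma trivIset_slices (T : Type) (R : realType) (f : T -> R) (e : R) :
  0 < e -> trivIset setT (fun b : nat => [set x | b%:R * e <= f x < b%:R * e + e]).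
Proof.
move=> e0; apply/trivIsetP.
have lt_slices (a b : nat) x : (a < b)%N -> b%:R * e <= x -> x < a%:R * e + e -> False.
  rewrite -(ler_nat R) -natr1 => ab bx xa.
  have : (a%:R + 1) * e <= b%:R * e by rewrite ler_pM2r.
  lra.
move=> a b _ _ ab; rewrite -subset0 => x [/= /andP[ax xa] /andP[bx xb]].
by move: ab; rewrite neq_ltn => /orP[/lt_slices|/lt_slices]; eauto.
Qed.

(** Boxes have finite area, as the Poisson counts require, and those of integer half-side exhaust
    the plane. *)
Definition box {R : realType} (M : R) : set (R * R) :=
  `[- M, M]%classic `*` `[- M, M]%classic.

Lemma measurable_box (R : realType) (M : R) : measurable (box M).
Proof. by apply: measurableX; exact: measurable_itv. Qed.

Lemma area_box_lty (R : realType) (M : R) : (area (box M) < +oo)%E.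
Proof.
set I : set R := `[- M, M]%classic.
have -> : area (box M) = (lebesgue_measure I * lebesgue_measure I)%E.
  by apply: product_measure1E; exact: measurable_itv.
by rewrite lebesgue_measure_itv/=; case: ifPn => _; rewrite -?EFinD -?EFinM ?mule0 ltry.
Qed.

(** * A measurable relation between the distances of two points is null *)

Section Ties.
Context d (T : measurableType d) (R : realType) (P : probability T R).
Context (lambda : R) (X : nat -> {RV P >-> (R * R)%type}).
Hypothesis lambda0 : 0 < lambda.
Hypothesis XP : poisson_process lambda X.
Context (g : R -> R) (i j : nat).
Hypothesis mg : measurable_fun setT g.
Hypothesis ij : i != j.

(** Here [g] is any measurable function. In the application it sends the squared distance of a LoS
    station to that of an NLoS station with the same mean power. *)
Let tie : set T := [set w | sqnorm (X j w) = g (sqnorm (X i w))].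

Let measurable_preim k (B : set (R * R)) : measurable B -> measurable (X k @^-1` B).
Proof. by move=> mB; rewrite -[_ @^-1` _]setTI; exact: measurable_funP. Qed.

Let measurable_sqnormX k : measurable_fun setT (fun w => sqnorm (X k w)).
Proof. by apply: measurableT_comp; [exact: measurable_sqnorm|exact: measurable_funP]. Qed.

Lemma measurable_tie : measurable tie.
Proof.
have -> : tie = setT `&` [set w | (sqnorm (X j w))%:E = (g (sqnorm (X i w)))%:E].
  by rewrite setTI; apply/seteqP; split => w; [move=> /= ->|case].
apply: measurable_eqe => //; apply/measurable_EFinP; first exact: measurable_sqnormX.
exact: (measurableT_comp mg (measurable_sqnormX i)).
Qed.

(* The points of index [j] are sorted into thin annuli [C b]; a tie then puts
   the point of index [i] either into the same annulus or into the set [A b] of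
   points whose image under [g] falls in it. Both the [A b] and the [C b] are
   disjoint, so that the double sum collapses to one factor [Num.sqrt e]. *)
Lemma tie_in_box_le (M e : R) : 0 <= M -> 0 < e ->
  (P (tie `&` X i @^-1` box M `&` X j @^-1` box M) <=
   (lambda ^+ 2 * (4 * M * Num.sqrt e))%:E * (area (box M) + area (box M)))%E.
Proof.
move=> M0 e0.
set D := box M; set E := tie `&` _ `&` _.
have mD : measurable D by exact: measurable_box.
pose slice (f : R * R -> R) (b : nat) := D `&` [set x | b%:R * e <= f x < b%:R * e + e].
have mslice f b : measurable_fun setT f -> measurable (slice f b).
  move=> mf; apply: measurableI => //.
  have := mf measurableT _ (measurable_itv `[b%:R * e, b%:R * e + e[).
  by rewrite setTI /preimage/=; congr measurable; apply/seteqP; split => x; rewrite /= in_itv.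
have trivslice f : trivIset setT (slice f).
  exact/trivIset_setIl/trivIset_slices.
pose C := slice sqnorm.
(* Removing [C b] makes the two sets of the pair disjoint, so that the counts are independent. The
   part removed is handled by the bound for two points in one set. *)
pose A b := slice (g \o sqnorm) b `\` C b.
have mgs : measurable_fun setT (g \o @sqnorm R).
  by apply: measurableT_comp => //; exact: measurable_sqnorm.
have mC b : measurable (C b) by apply: mslice; exact: measurable_sqnorm.
have mA b : measurable (A b) by apply: measurableD => //; exact: mslice.
have CD b : C b `<=` D by exact: subIsetl.
have AD b : A b `<=` D by move=> x [[]].
have trivA : trivIset setT A.
  rewrite (_ : A = fun b => slice (g \o sqnorm) b `&` ~` C b).
    exact/trivIset_setIr/trivslice.
  by apply/funext => b; rewrite /A setDE.
have areaC b : (area (C b) <= (4 * M * Num.sqrt e)%:E)%E.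
  apply: (area_thin_annulus (s := b%:R * e)) => //; first exact: ltW.
  move=> x [[/= xM _] xs]; split => //=.
  by move: xM; rewrite in_itv/= -ler_norml.
have areaD : (area D < +oo)%E.
  exact: area_box_lty.
have finD B : measurable B -> B `<=` D -> (area B < +oo)%E.
  by move=> mB BD; apply: le_lt_trans areaD; apply: le_measure; rewrite ?inE.
pose F b := (X i @^-1` A b `&` X j @^-1` C b) `|` (X i @^-1` C b `&` X j @^-1` C b).
have mF b : measurable (F b).
  by apply: measurableU; apply: measurableI; exact: measurable_preim.
have mE : measurable E.
  by apply: measurableI; [apply: measurableI; [exact: measurable_tie|]|]; exact: measurable_preim.
have EF : E `<=` \bigcup_b F b.
  move=> w [[/= tw Di] Dj].
  (* The integer part of this quotient is the index of the annulus that contains the point [j]. *)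
  have := @truncn_itv _ (sqnorm (X j w) / e).
  rewrite divr_ge0 ?addr_ge0 ?sqr_ge0// ?(ltW e0)// => /(_ isT).
  set b := Num.trunc _; rewrite ler_pdivlMr// ltr_pdivrMr// -natr1 mulrDl mul1r => tb.
  have Cj : C b (X j w) by [].
  exists b => //; have [Ci|Ci] := pselect (C b (X i w)); [by right|left].
  by split => //; split => //; split => //=; rewrite -tw.
apply: (le_trans (measure_sigma_subadditive P mF mE EF)).
set K := lambda ^+ 2 * _.
have K0 : 0 <= K by rewrite mulr_ge0 ?sqr_ge0 ?mulr_ge0 ?sqrtr_ge0.
(* In each product one factor [area (C b)] is replaced by the uniform annulus bound. The remaining
   areas are summable over [b], each family with total at most [area D]. *)
have PF b : (P (F b) <= K%:E * (area (A b) + area (C b)))%E.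
  apply: (@le_trans _ _ ((lambda ^+ 2)%:E * area (A b) * area (C b) +
                         (lambda ^+ 2)%:E * area (C b) * area (C b))%E).
    apply: (le_trans (measureU2 _ _ _)).
      by apply: measurableI; exact: measurable_preim.
      by apply: measurableI; exact: measurable_preim.
    apply: leeD.
      apply: (pair_in_disjoint lambda0 XP) => //; try exact: finD.
      by rewrite /A setDE -setIA setICl setI0.
    by apply: (pair_in_same lambda0 XP) => //; exact: finD.
  rewrite /K (EFinM (lambda ^+ 2)); move: (areaC b) (area_ge0 (A b)) (area_ge0 (C b)).
  move: (area (A b)) (area (C b)) => a c cs a0 c0.
  have l0 : (0 <= (lambda ^+ 2)%:E)%E by rewrite lee_fin sqr_ge0.
  rewrite ge0_muleDr//; apply: leeD;
    by rewrite muleAC; apply: lee_wpmul2r => //; apply: lee_wpmul2l.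
apply: (le_trans (lee_nneseries _ _)) => [b _ _|b _|]; [exact: measure_ge0|exact: PF|].
rewrite nneseriesZl => [|b _]; last by rewrite adde_ge0 ?area_ge0.
apply: lee_pmul => //; rewrite ?lee_fin//.
  by apply: nneseries_ge0 => b _ _; by rewrite adde_ge0 ?area_ge0.
rewrite nneseriesD => [|b _ _|b _ _]; try exact: area_ge0.
by apply: leeD; [exact: (sum_area_le mD mA trivA AD)|apply: (sum_area_le mD mC) => //; exact: trivslice].
Qed.

Lemma tie_in_box_null (M : R) : 0 <= M ->
  P (tie `&` X i @^-1` box M `&` X j @^-1` box M) = 0%E.
Proof.
move=> M0; apply/eqP; rewrite -measure_le0; apply/lee_addgt0Pr => e e0; rewrite add0e.
have /fineK areaD : area (box M) \is a fin_num.
  by rewrite ge0_fin_numE ?area_box_lty ?area_ge0.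
have V0 : 0 <= fine (area (box M)) by rewrite fine_ge0 ?measure_ge0.
pose V := fine (area (box M)).
pose K := lambda ^+ 2 * (4 * M) * (V + V).
have K0 : 0 <= K by rewrite mulr_ge0 ?addr_ge0// mulr_ge0 ?sqr_ge0// mulr_ge0.
(* The slice width will be the square of this number, to cancel the square root in the bound. Adding
   1 covers [K] = 0. *)
have s0 : 0 < e / (K + 1) by rewrite divr_gt0// (lt_le_trans ltr01)// lerDr.
apply: (le_trans (tie_in_box_le M0 (exprn_gt0 2 s0))).
rewrite -areaD -EFinD -EFinM lee_fin sqrtr_sqr gtr0_norm//.
have -> : lambda ^+ 2 * (4 * M * (e / (K + 1))) * (V + V) = K * (e / (K + 1)).
  by rewrite /K; ring.
rewrite mulrCA ger_pMr// ler_pdivrMr ?mul1r ?lerDl//; lra.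
Qed.

Lemma tie_null : P tie = 0%E.
Proof.
apply/negligibleP; first exact: measurable_tie.
have -> : tie = \bigcup_n (tie `&` X i @^-1` box n%:R `&` X j @^-1` box n%:R).
  apply/seteqP; split => [w tw|w [n _ [[]]]//].
  (* A single number bounding all four coordinates, so that one box contains both points. *)
  pose s := `|(X i w).1| + `|(X i w).2| + `|(X j w).1| + `|(X j w).2|.
  have s0 : 0 <= s by rewrite !addr_ge0.
  exists (Num.trunc s).+1 => //.
  have sn : s <= (Num.trunc s).+1%:R by have /andP[_ /ltW] := truncn_itv s0.
  have in_range a : `|a| <= s -> a \in `[- (Num.trunc s).+1%:R, (Num.trunc s).+1%:R].
    by move=> /le_trans/(_ sn); rewrite in_itv/= -ler_norml.
  have n1 := normr_ge0 (X i w).1; have n2 := normr_ge0 (X i w).2.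
  have n3 := normr_ge0 (X j w).1; have n4 := normr_ge0 (X j w).2.
  by split; [split => //|]; split; apply: in_range; rewrite /s; lra.
apply: negligible_bigcup => n; apply/negligibleP; last exact: tie_in_box_null.
apply: measurableI; [apply: measurableI; [exact: measurable_tie|]|];
  by apply: measurable_preim; exact: measurable_box.
Qed.

End Ties.

(** * Measurability of interference, association and coverage *)

Section Coverage.
Context d (T : measurableType d) (R : realType) (P : probability T R).
Context (p : params R) (N : network P).

(* The terms may be negative: [\esum] is used as a supremum over the countably
   many finite subsets of [S]. *)
Lemma measurable_esum (I : countType) (S : set I) (f : I -> T -> \bar R) :
  (forall i, measurable_fun setT (f i)) ->
  measurable_fun setT (fun w => \esum_(i in S) f i w)%E.
Proof.
move=> mf.
(* Every [n] is decoded as a list of indices, from which duplicates and indices outside [S] are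
   dropped; this enumerates all finite partial sums. A failed decoding gives 0, the empty sum, and
   leaves the supremum unchanged. *)
pose u (n : nat) w : \bar R :=
  if @choice.unpickle (seq I) n is Some s then
    (\sum_(i <- undup s | i \in S) f i w)%E else 0%E.
have mu n : measurable_fun setT (u n).
  rewrite /u; case: choice.unpickle => [s|]; last exact: measurable_cst.
  under eq_fun do rewrite -big_filter.
  exact: emeasurable_sum.
have -> : (fun w => \esum_(i in S) f i w)%E = (fun w => esups (u ^~ w) 0).
  apply/funext => w; rewrite /esups /= /sdrop /esum.
  congr ereal_sup; apply/seteqP; split => x /=.
  - move=> [A [finA AS] <-].
    exists (choice.pickle (fset_set A : seq I)) => //.
    rewrite /u choice.pickleK fsbig_finite//= undup_id ?fset_uniq//.
    rewrite big_mkcond big_seq [RHS]big_seq; apply: eq_bigr => i.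
    by rewrite in_fset_set// inE => /AS iS; rewrite ifT// inE.
  - move=> [n _ <-]; rewrite /u; case: choice.unpickle => [s|].
    + exists [set i | (i \in s) && (i \in S)].
        split; last by move=> i /= /andP[_]; rewrite inE.
        by apply: (sub_finite_set _ (finite_seq s)) => i /= /andP[].
      rewrite fsbig_finite/=; last first.
        by apply: (sub_finite_set _ (finite_seq s)) => i /= /andP[].
      rewrite -[RHS]big_filter; apply: perm_big; apply: uniq_perm.
      * exact: fset_uniq.
      * exact/filter_uniq/undup_uniq.
      move=> i; rewrite in_fset_set; last first.
        by apply: (sub_finite_set _ (finite_seq s)) => k /= /andP[].
      by rewrite mem_filter mem_undup andbC; apply/idP/idP; rewrite inE.
    + exists set0; last by rewrite fsbig_set0.
      by split; [exact: finite_set0|exact: sub0set].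
exact: measurable_fun_esups.
Qed.

(** The empty sum is one of the candidates, whatever the signs of the terms. This matters for the
    interference, since fadings are nonnegative only almost surely. *)
Lemma esum_sup_ge0 (I : choiceType) (S : set I) (f : I -> \bar R) :
  (0 <= \esum_(i in S) f i)%E.
Proof.
apply: ereal_sup_ubound; exists set0; last by rewrite fsbig_set0.
by split; [exact: finite_set0|exact: sub0set].
Qed.

Lemma measurable_distance b : measurable_fun setT (distance N b).
Proof.
(* The square root is written as a real power, to which [measurable_powR] applies. *)
have -> : distance N b = (fun x => x `^ 2^-1) \o (@sqnorm R \o location N b).
  apply/funext => w; rewrite /distance /dist0 /= powR12_sqrt//.
  by rewrite addr_ge0 ?sqr_ge0.
apply: measurableT_comp; first exact: measurable_powR.
apply: measurableT_comp; first exact: measurable_sqnorm.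
exact: measurable_funP.
Qed.

Lemma measurable_is_los b l : measurable [set w | is_los N b w = l].
Proof.
have mlos : measurable_fun setT (is_los N b) by exact: measurable_funP.
by have := mlos measurableT [set l]; rewrite setTI; apply.
Qed.

Lemma measurable_link_loss b :
  measurable_fun setT (fun w => path_loss p (is_los N b w) (distance N b w)).
Proof.
have -> : (fun w => path_loss p (is_los N b w) (distance N b w)) =
    (fun w => if is_los N b w then AL p * distance N b w `^ (- alphaL p)
              else ANL p * distance N b w `^ (- alphaNL p)).
  by apply/funext => w; rewrite /path_loss; case: (is_los N b w).
have mpow a c : measurable_fun setT (fun w => a * distance N b w `^ c).
  apply: measurable_funM; first exact: measurable_cst.
  by apply: (measurableT_comp (measurable_powR _)); exact: measurable_distance.
by apply: measurable_fun_ifT; [exact: measurable_funP|exact: mpow|exact: mpow].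
Qed.

Lemma measurable_mean_biased_power b :
  measurable_fun setT (mean_biased_power p N b).
Proof.
apply: measurable_funM; first exact: measurable_cst.
exact: measurable_link_loss.
Qed.

Lemma measurable_biased_power b : measurable_fun setT (biased_power p N b).
Proof.
apply: measurable_funM; last exact: measurable_link_loss.
by apply: measurable_funM; [exact: measurable_cst|exact: measurable_funP].
Qed.

Lemma measurable_interference b : measurable_fun setT (interference p N b).
Proof.
apply: (@measurable_esum bs) => b'; apply/measurable_EFinP.
exact: measurable_biased_power.
Qed.

Lemma measurable_serves b : measurable [set w | serves p N b w].
Proof.
have -> : [set w | serves p N b w] =
    ~` \bigcup_b' ~` (setT `&` [set w | mean_biased_power p N b' w <= mean_biased_power p N b w]).
  apply/seteqP; split => [w sw [b' _] []|w nsw b']; first by split => //; exact: sw.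
  by apply: contra_notT nsw => h; exists b' => //= -[_]; exact/negP.
apply: measurableC; apply: countable_bigcupT_measurable => [|b'].
  exact: (@countableP (tier * nat)%type).
by apply: measurableC; apply: measurable_fun_le => //; exact: measurable_mean_biased_power.
Qed.

Hypothesis hp : params_ok p.

(* Infinite interference gives SINR 0 because [+oo^-1 = 0]. *)
Lemma SINR_geE (gamma : R) b w : 0 < gamma ->
  (gamma%:E <= SINR p N b w)%E =
  (gamma%:E * (interference p N b w + (noise p)%:E) <= (biased_power p N b w)%:E)%E.
Proof.
move=> g0; rewrite /SINR.
have : (0 <= interference p N b w)%E by exact: esum_sup_ge0.
case: interference => [r||]//=; last first.
  rewrite addye// invey mule0 gt0_muley ?lte_fin// leye_eq/= lee_fin.
  by move=> _; apply/negbTE; rewrite -ltNge.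
rewrite lee_fin => r0; have n0 := noise_gt0 hp.
have rn : 0 < r + noise p by exact: ltr_wpDl.
by rewrite -EFinD inver gt_eqF// -EFinM lee_fin ler_pdivlMr// -EFinM lee_fin.
Qed.

Lemma measurable_SINR_ge (gamma : R) b : 0 < gamma ->
  measurable [set w | (gamma%:E <= SINR p N b w)%E].
Proof.
move=> g0; under eq_set do rewrite SINR_geE//.
rewrite -[X in measurable X]setTI; apply: measurable_lee => //.
  apply: emeasurable_funM; first exact: measurable_cst.
  apply: emeasurable_funD; last exact: measurable_cst.
  exact: measurable_interference.
by apply/measurable_EFinP; exact: measurable_biased_power.
Qed.

Lemma measurable_covered_via k los (gamma : R) : 0 < gamma ->
  measurable (covered_via p N k los gamma).
Proof.
move=> g0.
have -> : covered_via p N k los gamma =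
    \bigcup_i ([set w | serves p N (k, i) w] `&`
      ([set w | is_los N (k, i) w = los] `&`
       [set w | (gamma%:E <= SINR p N (k, i) w)%E])).
  by apply/seteqP; split => w [i]; [move=> []; exists i|move=> _ [? []]; exists i].
apply: bigcupT_measurable => i.
apply: measurableI; first exact: measurable_serves.
by apply: measurableI; [exact: measurable_is_los|exact: measurable_SINR_ge].
Qed.

(** * Splitting coverage into LoS and NLoS parts *)

Lemma coveredE k (gamma : R) :
  covered p N k gamma =
  covered_via p N k LoS gamma `|` covered_via p N k NLoS gamma.
Proof.
apply/seteqP; split => w.
  move=> [i [si gi]]; case E : (is_los N (k, i) w); [left|right]; exists i; by split.
by case=> -[i [? _ ?]]; exists i.
Qed.

(* Valid also at [r = 0] and [s = 0], where both path losses are the junk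
   value 0. *)
Lemma path_loss_tie (r s : R) : 0 <= s ->
  path_loss p LoS r = path_loss p NLoS s ->
  s = (AL p * r `^ (- alphaL p) / ANL p) `^ (- alphaNL p)^-1.
Proof.
move=> s0; rewrite /path_loss/= => ->.
have ANL0 := ANL_gt0 hp; have aNL0 := alphaNL_gt0 hp.
by rewrite mulrC mulKf ?gt_eqF// -powRrM divff ?powRr1// oppr_eq0 gt_eqF.
Qed.

Hypothesis hN : network_ok p N.

Lemma covered_via_both_null k (gamma : R) : 0 < gamma ->
  P (covered_via p N k LoS gamma `&` covered_via p N k NLoS gamma) = 0%E.
Proof.
move=> g0.
have mcov : measurable (covered_via p N k LoS gamma `&` covered_via p N k NLoS gamma).
  by apply: measurableI; exact: measurable_covered_via.
apply/negligibleP => //.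
(* The solution of [path_loss_tie], carried over to squared distances: take the root, solve for the
   NLoS distance, square. *)
pose g (u : R) := ((AL p * (u `^ 2^-1) `^ (- alphaL p) / ANL p) `^ (- alphaNL p)^-1) ^+ 2.
have mg : measurable_fun setT g.
  apply: measurable_funX; apply: (measurableT_comp (measurable_powR _)).
  apply: measurable_funM; last exact: measurable_cst.
  apply: measurable_funM; first exact: measurable_cst.
  by apply: (measurableT_comp (measurable_powR _)); exact: measurable_powR.
pose tie i j := [set w | sqnorm (location N (k, j) w) = g (sqnorm (location N (k, i) w))].
apply: (@negligibleS _ _ _ _ (\bigcup_i \bigcup_j (if i == j then set0 else tie i j))).
  move=> w [[i [si li _]] [j [sj lj _]]]; exists i => //; exists j => //.
  (* One station cannot be both LoS and NLoS. For two stations, each one's mean power dominates the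
     other's, and the common factor of the tier cancels, so the path losses agree. *)
  case: eqVneq => [ij|ij]; first by move: li lj; rewrite ij => ->.
  have := sj (k, i); have := si (k, j); rewrite /mean_biased_power/=.
  have pb : 0 < power p k * bias p k by rewrite mulr_gt0 ?power_gt0 ?bias_gt0.
  rewrite !ler_pM2l// li lj => h1 h2.
  have /path_loss_tie tie_eq : path_loss p LoS (distance N (k, i) w) =
      path_loss p NLoS (distance N (k, j) w).
    by apply/eqP; rewrite eq_le h1 h2.
  have sq0 (x : R * R) : 0 <= sqnorm x by rewrite addr_ge0 ?sqr_ge0.
  rewrite /tie /g /= powR12_sqrt// -tie_eq ?sqrtr_ge0//.
  by rewrite sqr_sqrtr ?sq0.
apply: negligible_bigcup => i; apply: negligible_bigcup => j.
case: eqVneq => [_|ij]; first exact: negligible_set0.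
have XP := tiers_poisson hN k.
apply/negligibleP; first exact: (measurable_tie (locations_of N k) i j mg).
exact: (tie_null (density_gt0 hp k) XP mg ij).
Qed.

(** Inclusion-exclusion: the two events may overlap at ties, but only in a null set. *)
Lemma covered_additive k (gamma : R) : 0 < gamma ->
  fine (P (covered p N k gamma)) = Pcov p N k LoS gamma + Pcov p N k NLoS gamma.
Proof.
move=> g0; rewrite coveredE /Pcov.
have mL := measurable_covered_via k LoS g0.
have mNL := measurable_covered_via k NLoS g0.
have -> : P (covered_via p N k LoS gamma `|` covered_via p N k NLoS gamma) =
    (P (covered_via p N k LoS gamma) + P (covered_via p N k NLoS gamma) -
     P (covered_via p N k LoS gamma `&` covered_via p N k NLoS gamma))%E.
  by apply: measureUfinl => //; rewrite (le_lt_trans (probability_le1 _ _))// ltry.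
by rewrite covered_via_both_null// sube0 fineD// fin_num_measure.
Qed.

End Coverage.

Theorem corollary2 (R : realType) (d : measure_display) (T : measurableType d)
    (P : probability T R) (p : params R) (N : network P)
    (hp : params_ok p) (hN : network_ok p N)
    (W eta gamma0 : R) (hW : 0 < W) (heta : 0 <= eta <= 1)
    (hgamma0 : 0 < gamma0) :
  macro_APT p N W eta gamma0 =
    density p MBS * eta * W * log2 (1 + gamma0) * Pcov p N MBS LoS gamma0
    + density p MBS * eta * W * log2 (1 + gamma0) * Pcov p N MBS NLoS gamma0.
Proof. by rewrite /macro_APT /APT covered_additive//; ring. Qed.
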